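(* Let $G$ be a divisible ordered group (possibly equipped with additional structure) whose complete theory is dp-minimal. Let $X\subseteq G$ be an infinite definable (with parameters) set. Then $X$ has non-empty interior, i.e. $X$ contains a non-trivial open interval of $G$.
   Context: An ordered group is a group with a linear order invariant under left and right multiplication. An inp-pattern of length $\kappa$ (in the variable $x$) is a sequence $(\phi^\alpha(x,y),k^\alpha)_{\alpha<\kappa}$ of formulas and positive integers for which there is an array $\langle a^\alpha_i : \alpha<\kappa, i<\lambda\rangle$, $\lambda\ge\omega$, such that for each $\alpha$ the set $\{\phi^\alpha(x,a^\alpha_i): i<\lambda\}$ is $k^\alpha$-inconsistent, and for every $\eta\in\lambda^\kappa$ the set $\{\phi^\alpha(x,a^\alpha_{\eta(\alpha)}):\alpha<\kappa\}$ is consistent. A theory is inp-minimal if there is no inp-pattern of length two with $x$ a single variable; it is dp-minimal if it is NIP (has the non-independence property) and inp-minimal. *)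

(* Defs.v *)
From HB Require Import structures.
From mathcomp Require Import all_boot all_order.
From mathcomp Require Import boolp classical_sets cardinality.

Set Implicit Arguments.
Unset Strict Implicit.
Unset Printing Implicit Defensive.

Local Open Scope classical_set_scope.

(** * First-order logic *)

Record language := Language {
  fun_symb : nat -> Type;
  rel_symb : nat -> Type }.

Record interp (L : language) (A : Type) := Interp {
  fun_int : forall n, fun_symb L n -> ('I_n -> A) -> A;
  rel_int : forall n, rel_symb L n -> ('I_n -> A) -> Prop }.

Record structure (L : language) := Structure {
  carrier :> Type;
  str_int : interp L carrier }.

(* Terms and formulas have their free variables in an arbitrary type [V]; a
   quantifier binds the variable [None : option V].  The other connectives are
   classically definable from [FFalse], [FImp] and [FAll]. *)
Inductive term (L : language) (V : Type) : Type :=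
| TVar : V -> term L V
| TApp : forall n, fun_symb L n -> ('I_n -> term L V) -> term L V.

Inductive formula (L : language) (V : Type) : Type :=
| FFalse : formula L V
| FEq : term L V -> term L V -> formula L V
| FRel : forall n, rel_symb L n -> ('I_n -> term L V) -> formula L V
| FImp : formula L V -> formula L V -> formula L V
| FAll : formula L (option V) -> formula L V.

Arguments TVar {L V}.
Arguments TApp {L V n}.
Arguments FFalse {L V}.
Arguments FRel {L V n}.

Definition env_cons (V A : Type) (a : A) (e : V -> A) (o : option V) : A :=
  if o is Some v then e v else a.

Definition env_sum (V W A : Type) (e : V -> A) (e' : W -> A) (s : V + W) : A :=
  match s with inl v => e v | inr w => e' w end.

Fixpoint teval (L : language) (M : structure L) (V : Type) (e : V -> M)
    (t : term L V) : M :=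
  match t with
  | TVar v => e v
  | TApp n f ts => fun_int (str_int M) f (fun i => teval e (ts i))
  end.

Fixpoint holds (L : language) (M : structure L) (V : Type) (phi : formula L V)
    : (V -> M) -> Prop :=
  match phi with
  | FFalse => fun _ => False
  | FEq t u => fun e => teval e t = teval e u
  | FRel n r ts => fun e => rel_int (str_int M) r (fun i => teval e (ts i))
  | FImp psi chi => fun e => holds psi e -> holds chi e
  | FAll psi => fun e => forall a : M, holds psi (env_cons a e)
  end.

Definition sentence (L : language) := formula L void.

Definition theory (L : language) := set (sentence L).

Definition models (L : language) (M : structure L) (T : theory L) : Prop :=
  forall phi, T phi -> holds phi (of_void M).

Definition complete_theory (L : language) (M : structure L) : theory L :=
  [set phi | holds phi (of_void M)].

(* The set defined in [M^n] by [phi(x, a)], for [phi(x, y)] with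
   [x = (x_0, ..., x_(n-1))] and [y = (y_0, ..., y_(m-1))]. *)
Definition instance (L : language) (M : structure L) (n m : nat)
    (phi : formula L ('I_n + 'I_m)) (a : 'I_m -> M) : set ('I_n -> M) :=
  [set x | holds phi (env_sum x a)].

Definition definable (L : language) (M : structure L) (X : set M) : Prop :=
  exists (m : nat) (phi : formula L ('I_1 + 'I_m)) (b : 'I_m -> M),
    X = [set x | instance phi b (fun=> x)].

(** * Dp-minimality *)

(* Families of formulas over [M] are given through the sets they define in
   [M^n].  By compactness, a family is realized in an elementary extension of
   [M] iff each of its finite subfamilies is realized in [M]. *)
Definition consistent (I A : Type) (F : I -> set A) : Prop :=
  forall J : set I, finite_set J -> \bigcap_(i in J) F i !=set0.

(* Subfamilies are counted by indices: [F i] and [F j] with [i <> j] count as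
   two members even if they coincide. *)
Definition k_inconsistent (k : nat) (I A : Type) (F : I -> set A) : Prop :=
  forall J : set I, (J #= `I_k)%card -> \bigcap_(i in J) F i = set0.

(* The array may live in any model of [T]. *)
Definition inp_pattern (L : language) (T : theory L) (n : nat) (K : Type)
    (m : K -> nat) (phi : forall al : K, formula L ('I_n + 'I_(m al)))
    (k : K -> nat) : Prop :=
  (forall al, 0 < k al) /\
  exists (M : structure L) (I : Type) (a : forall al : K, I -> 'I_(m al) -> M),
    [/\ models M T, infinite_set [set: I],
        forall al, k_inconsistent (k al) (fun i => instance (phi al) (a al i))
      & forall eta : K -> I,
          consistent (fun al => instance (phi al) (a al (eta al)))].

Definition inp_minimal (L : language) (T : theory L) : Prop :=
  ~ exists (m : 'I_2 -> nat) (phi : forall al, formula L ('I_1 + 'I_(m al)))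
           (k : 'I_2 -> nat), inp_pattern T phi k.

Definition independence_property (L : language) (T : theory L) (n m : nat)
    (phi : formula L ('I_n + 'I_m)) : Prop :=
  exists (M : structure L) (a : nat -> 'I_n -> M) (b : set nat -> 'I_m -> M),
    models M T /\ forall i S, instance phi (b S) (a i) <-> S i.

Definition NIP (L : language) (T : theory L) : Prop :=
  forall (n m : nat) (phi : formula L ('I_n + 'I_m)),
    ~ independence_property T phi.

Definition dp_minimal (L : language) (T : theory L) : Prop :=
  NIP T /\ inp_minimal T.

(** * Ordered groups with additional structure *)

(* The group is written multiplicatively and is not assumed to be abelian. *)
HB.mixin Record isOrderedGroup d G of Group G & Order.Total d G := {
  le_mulg2l : forall z x y : G, (x <= y)%O -> ((z * x)%g <= (z * y)%g)%O;
  le_mulg2r : forall z x y : G, (x <= y)%O -> ((x * z)%g <= (y * z)%g)%O }.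

#[short(type="orderedGroupType")]
HB.structure Definition OrderedGroup d :=
  { G of Group G & Order.Total d G & isOrderedGroup d G }.

Definition divisible (G : groupType) : Prop :=
  forall n, 0 < n -> forall x : G, exists y : G, (y ^+ n)%g = x.

Inductive og_fun : nat -> Type :=
| og_mul : og_fun 2
| og_one : og_fun 0
| og_inv : og_fun 1.

Inductive og_rel : nat -> Type :=
| og_lt : og_rel 2.

(* The language of ordered groups enriched by the symbols of [L]. *)
Definition og_language (L : language) : language :=
  Language (fun n => og_fun n + fun_symb L n)%type
           (fun n => og_rel n + rel_symb L n)%type.

Definition og_fun_int d (G : orderedGroupType d) n (f : og_fun n)
    : ('I_n -> G) -> G :=
  match f in og_fun n return ('I_n -> G) -> G with
  | og_mul => fun v => (v ord0 * v ord_max)%g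
  | og_one => fun _ => 1%g
  | og_inv => fun v => ((v ord0)^-1)%g
  end.

Definition og_rel_int d (G : orderedGroupType d) n (r : og_rel n)
    : ('I_n -> G) -> Prop :=
  match r in og_rel n return ('I_n -> G) -> Prop with
  | og_lt => fun v => (v ord0 < v ord_max)%O
  end.

Definition og_structure d (G : orderedGroupType d) (L : language)
    (S : interp L G) : structure (og_language L) :=
  @Structure (og_language L) G
    (@Interp (og_language L) G
      (fun n f => match f with
                  | inl f => og_fun_int f
                  | inr f => fun_int S f
                  end)
      (fun n r => match r with
                  | inl r => og_rel_int r
                  | inr r => rel_int S r
                  end)).

(* Main.v *)
Require Import Defs.
From mathcomp Require Import all_boot all_order.
From mathcomp Require Import boolp classical_sets cardinality.
From mathcomp Require Import functions filter zify.

(* The germs at 1 of the translates of a definable set X by its points are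
   finitely many: by Ramsey and NIP, infinitely many germs would give pairs of
   points separated by k-inconsistent sets, all of which meet infinitely many
   disjoint shells around 1.  Hence some infinite definable subset Y of X has
   the same germ at all of its points.  Such a Y is not discrete: the translates
   of Y by small elements would be disjoint and meet disjoint neighbourhoods of
   points of Y.  Near one of its points, Y coincides with the translate of a
   local subgroup H.  If H is not a neighbourhood of 1, take t outside H and
   close to 1, and s with s^(N!) = t; then the N first powers of s lie in
   distinct cosets of H, and these cosets all meet disjoint neighbourhoods of N
   points of Y, which contradicts inp-minimality.  Patterns are only built with
   arrays of finite length, and an ultrapower turns these into infinite ones. *)

Set Implicit Arguments.
Unset Strict Implicit.
Unset Printing Implicit Defensive.

Import Order.TTheory.
Local Open Scope classical_set_scope.

(** * Ultrapowers and compactness *)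

Lemma ultra_exists_oo :
  exists U : set_system nat,
    UltraFilter U /\ forall m, U [set n | m <= n].
Proof.
have [U [UU sub]] := ultraFilterLemma eventually_filter.
by exists U; split=> // m; apply: sub; exists m.
Qed.

Section Ultrapower.
Variables (L : language) (M : structure L) (U : set_system nat).
Context {UU : UltraFilter U}.

Lemma ultra_imp (A B : set nat) :
  (U A -> U B) <-> U [set n | A n -> B n].
Proof.
split=> [AB|UAB UA]; last first.
  by apply: (filterS _ (filterI UAB UA)) => n [h /h].
case: (in_ultra_setVsetC A UU) => [/AB|]; apply: filterS => n.
  by move=> Bn.
by move=> nA /nA.
Qed.

Lemma ultra_forall (I : finType) (A : I -> set nat) :
  (forall i, U (A i)) -> U [set k | forall i, A i k].
Proof.
move=> UA; suff: U [set k | forall i, i \in enum I -> A i k].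
  by apply: filterS => k h i; apply: h; rewrite mem_enum.
elim: (enum I) => [|i s IHs]; first by apply: filterE.
apply: (filterS _ (filterI (UA i) IHs)) => k [Aik h] j.
by rewrite inE => /orP[/eqP->|/h].
Qed.

Definition ultra_eq (f g : nat -> M) : Prop := U [set n | f n = g n].

Lemma ultra_eq_trans f g h : ultra_eq f g -> ultra_eq g h -> ultra_eq f h.
Proof. by move=> fg gh; apply: (filterS _ (filterI fg gh)) => n [/= -> ->]. Qed.

Lemma ultra_eq_sym f g : ultra_eq f g -> ultra_eq g f.
Proof. by apply: filterS => n /= ->. Qed.

(** The quotient of [nat -> M] by [ultra_eq]; a class is stored as the predicate [ultra_eq f] of any
    of its members. *)
Definition ultra_carrier := {c : set (nat -> M) | exists f, c = ultra_eq f}.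

Definition ultra_class f : ultra_carrier :=
  exist _ (ultra_eq f) (ex_intro _ f erefl).

Definition ultra_repr (c : ultra_carrier) : nat -> M := sval (cid (svalP c)).

Lemma ultra_reprK c : ultra_class (ultra_repr c) = c.
Proof.
rewrite /ultra_repr; case: cid => f /=; case: c => c cP /= cf.
exact: eq_exist.
Qed.

Lemma ultra_classP f g : ultra_class f = ultra_class g <-> ultra_eq f g.
Proof.
split=> [/(congr1 sval) /= fg|fg].
  have : ultra_eq g g by apply: filterE.
  by rewrite -fg.
apply: eq_exist; apply/funext => h; apply/propext.
split; apply: ultra_eq_trans => //; exact: ultra_eq_sym.
Qed.

Lemma ultra_repr_class f : ultra_eq (ultra_repr (ultra_class f)) f.
Proof. by apply/ultra_classP; rewrite ultra_reprK. Qed.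

(** Symbols are interpreted on chosen representatives. By [ultra_repr_class], another choice changes
    the coordinates only outside a set of [U]. *)
Definition ultrapower : structure L :=
  @Structure L ultra_carrier (@Interp L ultra_carrier
    (fun n f v =>
       ultra_class
         (fun k => fun_int (str_int M) f (fun i => ultra_repr (v i) k)))
    (fun n r v =>
       U [set k | rel_int (str_int M) r (fun i => ultra_repr (v i) k)])).

Lemma teval_ultrapower (V : Type) (e : V -> nat -> M) (t : term L V) :
  teval (M := ultrapower) (fun v => ultra_class (e v)) t =
  ultra_class (fun k => teval (fun v => e v k) t).
Proof.
elim: t => [//|n f ts IH] /=; apply/ultra_classP.
have := ultra_forall
  (fun i => ultra_repr_class (fun k => teval (e^~ k) (ts i))).
apply: filterS => k /= h; congr fun_int; apply/funext => i.
by rewrite IH h.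
Qed.

Lemma Los (V : Type) (phi : formula L V) (e : V -> nat -> M) :
  holds (M := ultrapower) phi (fun v => ultra_class (e v)) <->
  U [set k | holds phi (fun v => e v k)].
Proof.
elim: phi e => {V} [V|V t u|V n r ts|V psi IH1 chi IH2|V psi IH] e /=.
- by split=> // /filter_not_empty.
- by rewrite !teval_ultrapower; apply: ultra_classP.
- have h := ultra_forall
    (fun i => ultra_repr_class (fun k => teval (e^~ k) (ts i))).
  split=> H; apply: (filterS _ (filterI h H)) => k [/= hk];
    congr rel_int; apply/funext => i; by rewrite teval_ultrapower hk.
- by rewrite -ultra_imp IH1 IH2.
have consE f : env_cons (ultra_class f) (fun v => ultra_class (e v)) =
    fun o => ultra_class (env_cons f e o) by apply/funext => -[].
have consk f k : env_cons (f k) (e^~ k) = (env_cons f e)^~ k.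
  by apply/funext => -[].
split=> [H|H a].
  case: (in_ultra_setVsetC
      [set k | forall a, holds psi (env_cons a (e^~ k))] UU) => // nH.
  have [k0 /= /existsNP[a0 _]] := filter_ex nH.
  (* One counterexample is collected at each index that has one; [a0] is the default value at the
     other indices. *)
  have /choice [f fP] : forall k, exists a,
      ~ (forall a, holds psi (env_cons a (e^~ k))) ->
      ~ holds psi (env_cons a (e^~ k)).
    move=> k; have [h|/existsNP[a ah]] :=
      pselect (forall a, holds psi (env_cons a (e^~ k))); last by exists a.
    by exists a0.
  have := H (ultra_class f); rewrite consE IH => Hf.
  have [k [/= /fP]] := filter_ex (filterI nH Hf).
  by rewrite consk.
rewrite -(ultra_reprK a) consE IH.
by apply: filterS H => k /= /(_ (ultra_repr a k)); rewrite consk.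
Qed.

Lemma ultrapower_models : models ultrapower (complete_theory M).
Proof.
move=> phi phiM; have -> : of_void ultrapower =
    fun v => ultra_class (fun=> of_void M v) by apply/funext => -[].
apply/Los; apply: filterE => k /=.
by have <- : of_void M = (fun v => of_void M v) by apply/funext => -[].
Qed.

Lemma instance_ultrapower n m (phi : formula L ('I_n + 'I_m))
    (b : 'I_m -> nat -> M) (a : 'I_n -> nat -> M) :
  @instance L ultrapower n m phi (fun i => ultra_class (b i))
    (fun i => ultra_class (a i)) <->
  U [set k | instance phi (b^~ k) (a^~ k)].
Proof.
rewrite /instance /=.
have -> : env_sum (fun i => ultra_class (a i)) (fun i => ultra_class (b i)) =
    fun v => ultra_class (env_sum a b v) by apply/funext => -[].
rewrite Los; suff -> : [set k | holds phi (fun v => env_sum a b v k)] =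
  [set k | holds phi (env_sum (a ^~ k) (b ^~ k))] by [].
by apply/funext => k; congr holds; apply/funext => -[].
Qed.

End Ultrapower.

(** Compactness for inp-patterns. The [i]-th entry of an infinite row is the class of
    [fun N => a N i]. A condition on finitely many indices is meaningful for all large [N], hence
    [U]-almost everywhere, and Łoś's theorem carries inconsistency and consistency over to the
    ultrapower. *)
Lemma finite_inp_arrays (L : language) (M : structure L) (m : nat)
    (phi psi : formula L ('I_1 + 'I_m)) (k l : nat) :
  inp_minimal (complete_theory M) -> 0 < k -> 0 < l ->
  (forall N, exists a b : nat -> 'I_m -> M,
    [/\ forall g, set_inj `I_k g -> (forall i, i < k -> g i < N) ->
          ~ exists x, forall i, i < k -> instance phi (a (g i)) x,
        forall g, set_inj `I_l g -> (forall i, i < l -> g i < N) ->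
          ~ exists x, forall i, i < l -> instance psi (b (g i)) x
      & forall i j, i < N -> j < N ->
          exists x, instance phi (a i) x /\ instance psi (b j) x]) ->
  False.
Proof.
move=> minT k0 l0 /choice [a /choice [b ab]].
have [U [UU Uoo]] := ultra_exists_oo.
pose c (al : 'I_2) N := if al == ord0 then a N else b N.
pose chi (al : 'I_2) := if al == ord0 then phi else psi.
pose K (al : 'I_2) := if al == ord0 then k else l.
have cP N (al : 'I_2) g : set_inj `I_(K al) g ->
    (forall i, i < K al -> g i < N) ->
    ~ exists x, forall i, i < K al -> instance (chi al) (c al N (g i)) x.
  have [h1 h2 _] := ab N; rewrite /K /chi /c.
  by case: (al == ord0); [exact: h1|exact: h2].
apply: minT; exists (fun=> m), chi, K. split=> [al|].
  by rewrite /K; case: ifP.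
pose A (al : 'I_2) (i : nat) (v : 'I_m) : ultra_carrier M U :=
  ultra_class U (fun N => c al N i v).
exists (ultrapower M U), nat, A; split.
- exact: ultrapower_models.
- exact: infinite_nat.
- move=> al J /card_esym /card_set_bijP [g [gJ ginj _]].
  rewrite -subset0 => x xJ.
  have {}xJ i : i < K al -> U [set N | g i < N /\
      instance (chi al) (c al N (g i)) (fun v => ultra_repr (x v) N)].
    move=> iK; have := xJ (g i) (gJ i iK).
    have {1}-> : x = fun v => ultra_class U (ultra_repr (x v)).
      by apply/funext => v; rewrite ultra_reprK.
    by move/instance_ultrapower; apply: filterI; apply: Uoo.
  have UN := @ultra_forall _ UU _ _ (fun i : 'I_(K al) => xJ i (ltn_ord i)).
  have [N NP] := filter_ex UN.
  apply: (cP N al g) => // [i iK|]; first by have [] := NP (Ordinal iK).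
  exists (fun v => ultra_repr (x v) N) => i iK.
  by have [] := NP (Ordinal iK).
move=> eta J _.
have /choice [x xP] : forall N, exists x : 'I_1 -> M, eta ord0 < N ->
    eta ord_max < N -> forall al, instance (chi al) (c al N (eta al)) x.
  move=> N; have [[h1 h2]|nh] := pselect (eta ord0 < N /\ eta ord_max < N).
    have [_ _ /(_ _ _ h1 h2) [x [x1 x2]]] := ab N.
    exists x => _ _ al; rewrite /chi /c.
    case: ifP => [/eqP->//|/eqP al0].
    suff -> : al = ord_max; first exact: x2.
    by case: al al0 => -[|[|//]] p al0; [case: al0|]; exact: val_inj.
  (* The array of length 1 supplies a default point for those [N] that are too small for [eta]. *)
  have [_ _ /(_ 0 0 isT isT) [x _]] := ab 1.
  by exists x => h1 h2; case: nh.
exists (fun v => ultra_class U (x^~ v)) => al _.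
apply/instance_ultrapower.
apply: (filterS _ (filterI (Uoo (eta ord0).+1) (Uoo (eta ord_max).+1))).
by move=> N [h0 h1]; exact: xP.
Qed.

(** Compactness for shattering: in the ultrapower, the class of [fun N => b (N, S)] cuts out [S],
    since [i < N] holds for almost every [N]. *)
Lemma finite_NIP_arrays (L : language) (M : structure L) (n m : nat)
    (phi : formula L ('I_n + 'I_m)) :
  NIP (complete_theory M) ->
  (forall N, exists a : nat -> 'I_n -> M, forall S : set nat,
    exists b, forall i, i < N -> instance phi b (a i) <-> S i) -> False.
Proof.
move=> nip /choice [a] aP.
have /choice [b bP] : forall NS : nat * set nat, exists b, forall i, i < NS.1 ->
    instance phi b (a NS.1 i) <-> NS.2 i by move=> [N S]; exact: aP.
have [U [UU Uoo]] := ultra_exists_oo.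
apply: (nip n m phi).
exists (ultrapower M U), (fun i v => ultra_class U (fun N => a N i v)),
  (fun S v => ultra_class U (fun N => b (N, S) v)).
split=> [|i S]; first exact: ultrapower_models.
rewrite instance_ultrapower.
have H := Uoo i.+1; split.
  by move=> /(filterI H) /filter_ex [N [/= iN /(bP (N, S) i iN)]].
by move=> Si; apply: filterS H => N /= iN; apply/(bP (N, S) i iN).
Qed.

(** * Ramsey's theorem *)

Lemma greedy_sequence (A : Type) (Q : seq A -> A -> Prop) :
  (forall s, exists x, Q s x) ->
  exists a : nat -> A, forall n, Q (mkseq a n) (a n).
Proof.
move=> /choice [f fP].
pose s := fix s n := if n is n'.+1 then rcons (s n') (f (s n')) else [::].
exists (fun n => f (s n)) => n.
suff -> : mkseq (fun n => f (s n)) n = s n by [].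
by elim: n => [//|n IH]; rewrite mkseqS IH.
Qed.

Lemma infinite_pigeonhole (C : finType) (c : nat -> C) :
  exists d, forall m, exists2 n, m <= n & c n = d.
Proof.
apply: contrapT => /forallNP H.
have /choice [b bP] : forall d, exists m, forall n, m <= n -> c n <> d.
  move=> d; have /existsNP [m mP] := H d.
  by exists m => n mn cn; apply: mP; exists n.
pose m := \max_d b d.
exact: (bP (c m) m (leq_bigmax (c m)) erefl).
Qed.

Lemma increasing_subsequence (P : nat -> Prop) :
  (forall m, exists2 n, m <= n & P n) ->
  exists h : nat -> nat, {homo h : i j / i < j} /\ forall n, P (h n).
Proof.
move=> H; have /choice [f fP] : forall m, exists n, m <= n /\ P n.
  by move=> m; have [n] := H m; exists n.
exists (fun n => iter n (f \o succn) (f 0)); split.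
  apply: homo_ltn => [y x z|n /=]; first exact: ltn_trans.
  by have [] := fP (iter n (f \o succn) (f 0)).+1.
by case=> [|n] /=; apply: (fP _).2.
Qed.

Lemma homo_ltn_mono (h : nat -> nat) :
  {homo h : i j / i < j} -> forall i j, (h i < h j) = (i < j).
Proof. by move=> hh; apply: leqW_mono; exact: leq_mono. Qed.

(** An [r]-element set is represented by its increasing enumeration. By induction on [r], nested
    infinite sets are chosen so that the colour of a set depends only on its least element; the
    pigeonhole principle then makes this colour constant. *)
Lemma ramsey (C : finType) (r : nat) (f : seq nat -> C) :
  exists (h : nat -> nat) (c : C), {homo h : i j / i < j} /\
    forall s, size s = r -> sorted ltn s -> f (map h s) = c.
Proof.
elim: r f => [|r IH] f.
  by exists id, (f [::]); split=> // s /size0nil ->.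
have /choice [g gP] : forall k : nat -> nat, exists hc : (nat -> nat) * C,
    {homo hc.1 : i j / i < j} /\ forall s, size s = r -> sorted ltn s ->
      f (k 0 :: map (k \o succn \o hc.1) s) = hc.2.
  move=> k; have [h [c hc]] := IH (fun s => f (k 0 :: map (k \o succn) s)).
  by exists (h, c); split=> [|s sz ss]; [case: hc|rewrite map_comp; apply hc.2].
(* [k n] enumerates the [n]-th nested set. The next one drops the least element [k n 0] and thins
   out the rest by the induction hypothesis. *)
pose k := fix k n := if n is n'.+1 then k n' \o succn \o (g (k n')).1 else id.
have gh n : {homo (g (k n)).1 : i j / i < j} by have [] := gP (k n).
have kh n : {homo k n : i j / i < j}.
  by elim: n => // n IHn i j ij /=; apply: IHn; rewrite ltnS; apply: gh.
have kD n m : exists2 l : nat -> nat, k (n + m) =1 k n \o l &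
    {homo l : i j / i < j}.
  elim: m => [|m [l lP lh]]; first by exists id => //; rewrite addn0.
  exists (l \o succn \o (g (k (n + m))).1).
    by move=> i; rewrite addnS /= lP.
  by move=> i j ij /=; apply: lh; rewrite ltnS; apply: gh.
have k_in n m : n < m -> exists i, k m 0 = k n.+1 i.
  move=> nm; have [l lP _] := kD n.+1 (m - n.+1).
  by exists (l 0); have := lP 0; rewrite subnKC.
pose e n := k n 0.
have eh : {homo e : i j / i < j}.
  apply: homo_ltn => [y x z|n]; first exact: ltn_trans.
  by rewrite /e /=; apply: kh.
pose c n := (g (k n)).2.
(* The terms after [e n] all lie in the range of [k n.+1], where [gP] has fixed the colour of the
   sets with least element [e n]. *)
have ec n s : size s = r -> sorted ltn s -> all (ltn n) s ->
    f (e n :: map e s) = c n.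
  move=> sz ss ns.
  have /choice [i iP] : forall m, exists i, n < m -> k m 0 = k n.+1 i.
    move=> m; have [/k_in [i ->]|] := boolP (n < m); first by exists i.
    by exists 0.
  have [_ gk] := gP (k n); rewrite /c -(gk (map i s)) ?size_map -?map_comp //.
    congr (f (_ :: _)); apply/eq_in_map => m /(allP ns) /= nm.
    by rewrite /e iP.
  rewrite sorted_map; apply: (sub_in_sorted _ ns ss) => x y /= nx ny xy.
  by rewrite -(homo_ltn_mono (kh n.+1)) -!iP //; apply: eh.
have [d dP] := infinite_pigeonhole c.
have [h [hh hd]] := increasing_subsequence dP.
exists (e \o h), d; split=> [i j ij|[//|n s] [sz] ss].
  by apply: eh; apply: hh.
rewrite /= map_comp ec ?size_map //.
  by rewrite sorted_map; apply: sub_sorted (path_sorted ss) => x y; apply: hh.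
rewrite all_map; apply: sub_all (order_path_min ltn_trans ss) => x /=.
exact: hh.
Qed.

Definition separates (A I : Type) (P : A -> I -> Prop) (x : A) (i j : I) :
    Prop :=
  ~ (P x i <-> P x j).

(** Seen as a family of sets indexed by [nat], [P] either has a subsequence whose consecutive pairs
    have [k]-inconsistent symmetric differences, or shatters [k] indices. Ramsey's theorem for sets
    of [2k] indices decides which. Under NIP the second case must fail for some [k]. *)
Lemma ramsey_separation (A : Type) (P : A -> nat -> Prop) (k : nat) :
  (exists h : nat -> nat, {homo h : i j / i < j} /\
    forall g, set_inj `I_k g -> ~ exists x, forall i, i < k ->
      separates P x (h (g i).*2) (h (g i).*2.+1)) \/
  (exists b : nat -> nat, forall S : set nat,
     exists x, forall i, i < k -> P x (b i) <-> S i).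
Proof.
pose Q (l : seq nat) (u : k.-tuple bool) := exists x, forall i, i < k ->
  (P x (nth 0 l i.*2) <-> nth false u i) /\
  (P x (nth 0 l i.*2.+1) <-> ~~ nth false u i).
(* The colour is a chosen sign pattern with which a single [x] separates all consecutive pairs of
   [l], or [None] if there is no such [x]. *)
pose f (l : seq nat) : option (k.-tuple bool) :=
  if pselect (exists u, Q l u) is left p then Some (sval (cid p)) else None.
have [h [c [hh hc]]] := ramsey k.*2 f.
have sorted_mkseq_lt (F : nat -> nat) :
    (forall i j, i < j -> j < k.*2 -> F i < F j) -> sorted ltn (mkseq F k.*2).
  move=> Fh; rewrite /mkseq sorted_map.
  have Pk : all (fun i => i < k.*2) (iota 0 k.*2).
    by apply/allP => i; rewrite mem_iota.
  apply: (sub_in_sorted _ Pk (iota_ltn_sorted _ _)) => i j _ jk ij /=.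
  exact: Fh.
case: c hc => [u|] hc; [right|left].
  (* Each index [3 i + 1] has a spare neighbour on either side. Paired with the next index it comes
     first and receives the [i]-th sign of [u]; paired with the previous one it comes second and
     receives the opposite sign. [L] selects the pairing that yields [S i]. *)
  exists (fun i => h (3 * i).+1) => S.
  pose L := mkseq (fun j =>
    3 * j./2 + odd j + (`[< S j./2 >] == nth false u j./2)) k.*2.
  have := hc L; rewrite size_mkseq => /(_ erefl).
  have /[swap]/[apply] : sorted ltn L.
    apply: sorted_mkseq_lt => i j ij jk.
    have [e|ne] := eqVneq i./2 j./2; last first.
      by case: (`[< S i./2 >] == _); case: (`[< S j./2 >] == _); lia.
    by rewrite e ltn_add2r; lia.
  rewrite /f; case: pselect => // p [up]; case: (cid p) up => /= v Qv uv.
  subst v; case: Qv => x xP; exists x => i ik; have := xP i ik.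
  have ik1 : i.*2.+1 < k.*2 by rewrite ltn_Sdouble.
  have ik2 : i.*2 < k.*2 by rewrite ltn_double.
  rewrite !(nth_map 0 0 h) ?size_mkseq // /L !nth_mkseq //=.
  rewrite uphalf_double doubleK odd_double /=.
  have [Su|Su] := eqVneq `[< S i >] (nth false u i).
    by rewrite -Su addn0 addn1 => -[-> _]; rewrite asboolE.
  rewrite !addn0 !addn1 => -[_ ->].
  rewrite -(asboolE (S i)); have -> // : `[< S i >] = ~~ nth false u i.
  by case: `[< S i >] Su; case: (nth false u i).
exists h; split=> // g ginj [x xP].
(* The colour [None] speaks of increasing lists only, while [g] is merely injective: its values are
   sorted first. *)
pose l := sort leq (mkseq g k).
have szl : size l = k by rewrite size_sort size_mkseq.
have lt_l : sorted ltn l.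
  rewrite ltn_sorted_uniq_leq sort_uniq (sort_sorted leq_total) andbT.
  apply/mkseq_uniqP => i j; rewrite !inE => ik jk.
  by apply: ginj; rewrite inE.
have lP i : i < k -> exists2 j, j < k & nth 0 l i = g j.
  move=> ik; have : nth 0 l i \in l by rewrite mem_nth ?szl.
  by rewrite mem_sort => /mapP[j]; rewrite mem_iota => jk ->; exists j.
pose L := mkseq (fun j => (nth 0 l j./2).*2 + odd j) k.*2.
have := hc L; rewrite size_mkseq => /(_ erefl).
have /[swap]/[apply] : sorted ltn L.
  apply: sorted_mkseq_lt => i j ij jk.
  have [e|ne] := eqVneq i./2 j./2.
    by rewrite e ltn_add2l; lia.
  suff : nth 0 l i./2 < nth 0 l j./2 by lia.
  by apply: (sorted_ltn_nth ltn_trans 0 lt_l); rewrite ?inE ?szl; lia.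
rewrite /f; case: pselect => // nQ _; apply: nQ.
exists [tuple `[< P x (h (nth 0 l i).*2) >] | i < k], x => i ik.
rewrite -(tnth_nth false _ (Ordinal ik)) tnth_mktuple.
have ik1 : i.*2.+1 < k.*2 by rewrite ltn_Sdouble.
have ik2 : i.*2 < k.*2 by rewrite ltn_double.
rewrite !(nth_map 0 0 h) ?size_mkseq // /L !nth_mkseq //=.
rewrite uphalf_double doubleK odd_double /=.
have [j jk ->] := lP i ik.
rewrite addn0 addn1 asboolE; split=> //.
rewrite -asbool_neg asboolE; have := xP j jk; rewrite /separates.
have := EM (P x (h (g j).*2)); have := EM (P x (h (g j).*2.+1)); tauto.
Qed.

(** * Definable relations *)

Fixpoint term_rename (L : language) (V W : Type) (s : V -> W) (t : term L V) :
    term L W :=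
  match t with
  | TVar v => TVar (s v)
  | TApp _ f ts => TApp f (fun i => term_rename s (ts i))
  end.

Fixpoint formula_rename (L : language) (V : Type) (phi : formula L V) :
    forall W : Type, (V -> W) -> formula L W :=
  match phi with
  | FFalse => fun _ _ => FFalse
  | FEq t u => fun _ s => FEq (term_rename s t) (term_rename s u)
  | FRel _ r ts => fun _ s => FRel r (fun i => term_rename s (ts i))
  | FImp psi chi => fun _ s =>
      FImp (formula_rename psi s) (formula_rename chi s)
  | FAll psi => fun _ s => FAll (formula_rename psi (omap s))
  end.

Lemma teval_rename (L : language) (M : structure L) (V W : Type) (s : V -> W)
    (t : term L V) (e : W -> M) :
  teval e (term_rename s t) = teval (e \o s) t.
Proof.
by elim: t => [//|n f ts IH] /=; congr fun_int; apply/funext => i; exact: IH.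
Qed.

Lemma holds_rename (L : language) (M : structure L) (V : Type)
    (phi : formula L V) (W : Type) (s : V -> W) (e : W -> M) :
  holds (formula_rename phi s) e <-> holds phi (e \o s).
Proof.
elim: phi W s e => {V} [V|V t u|V n r ts|V psi IH1 chi IH2|V psi IH] W s e //=.
- by rewrite !teval_rename.
- suff -> : (fun i => teval e (term_rename s (ts i))) =
            (fun i => teval (e \o s) (ts i)) by [].
  by apply/funext => i; exact: teval_rename.
- by rewrite IH1 IH2.
have H a : holds (formula_rename psi (omap s)) (env_cons a e) <->
    holds psi (env_cons a (e \o s)).
  by rewrite IH; suff -> : env_cons a e \o omap s = env_cons a (e \o s) by [];
    apply/funext => -[].
by split=> + a => /(_ a)/H.
Qed.

Section Definability.
Variables (L : language) (M : structure L) (p : nat) (b : 'I_p -> M).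

(** Definability is a property of predicates on environments, with the parameters [b] fixed. Closure
    lemmas can then follow the shape of a statement, without any formula being written out. *)
Definition definable_rel (V : Type) (R : (V -> M) -> Prop) : Prop :=
  exists phi : formula L (V + 'I_p),
    forall e, holds phi (env_sum e b) <-> R e.

Definition definable_fun (V : Type) (f : (V -> M) -> M) : Prop :=
  exists t : term L (V + 'I_p), forall e, teval (env_sum e b) t = f e.

Lemma definable_var (V : Type) (v : V) : definable_fun (fun e => e v).
Proof. by exists (TVar (inl v)). Qed.

Lemma definable_ext (V : Type) (R R' : (V -> M) -> Prop) :
  (forall e, R e <-> R' e) -> definable_rel R -> definable_rel R'.
Proof. by move=> RR' [phi H]; exists phi => e; rewrite H. Qed.

Lemma definable_eq (V : Type) (f g : (V -> M) -> M) :
  definable_fun f -> definable_fun g -> definable_rel (fun e => f e = g e).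
Proof. by move=> [t tf] [u ug]; exists (FEq t u) => e /=; rewrite tf ug. Qed.

Lemma definable_imp (V : Type) (R R' : (V -> M) -> Prop) :
  definable_rel R -> definable_rel R' -> definable_rel (fun e => R e -> R' e).
Proof.
by move=> [phi H] [psi H']; exists (FImp phi psi) => e /=; rewrite H H'.
Qed.

Lemma definable_false (V : Type) : definable_rel (fun _ : V -> M => False).
Proof. by exists FFalse. Qed.

Lemma definable_not (V : Type) (R : (V -> M) -> Prop) :
  definable_rel R -> definable_rel (fun e => ~ R e).
Proof. by move=> dR; apply: definable_imp => //; exact: definable_false. Qed.

Lemma definable_and (V : Type) (R R' : (V -> M) -> Prop) :
  definable_rel R -> definable_rel R' -> definable_rel (fun e => R e /\ R' e).
Proof.
move=> dR dR'; apply: (definable_ext (R := fun e => ~ (R e -> ~ R' e))).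
  by move=> e; split=> [/not_implyP[Re /contrapT]|[Re R'e] /(_ Re)].
by apply: definable_not; apply: definable_imp => //; exact: definable_not.
Qed.

Lemma definable_iff (V : Type) (R R' : (V -> M) -> Prop) :
  definable_rel R -> definable_rel R' -> definable_rel (fun e => R e <-> R' e).
Proof. by move=> dR dR'; apply: definable_and; exact: definable_imp. Qed.

Lemma definable_all (V : Type) (R : M -> (V -> M) -> Prop) :
  definable_rel (fun e => R (e None) (fun v => e (Some v))) ->
  definable_rel (fun e => forall a, R a e).
Proof.
move=> [phi H].
pose s (o : option V + 'I_p) : option (V + 'I_p) :=
  match o with
  | inl None => None
  | inl (Some v) => Some (inl v)
  | inr i => Some (inr i)
  end.
exists (FAll (formula_rename phi s)) => e /=.
have Ha a : holds (formula_rename phi s) (env_cons a (env_sum e b)) <-> R a e.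
  rewrite holds_rename; have -> : env_cons a (env_sum e b) \o s =
      env_sum (env_cons a e) b by apply/funext => -[[]|].
  by rewrite H.
by split=> + a => /(_ a)/Ha.
Qed.

Lemma definable_ex (V : Type) (R : M -> (V -> M) -> Prop) :
  definable_rel (fun e => R (e None) (fun v => e (Some v))) ->
  definable_rel (fun e => exists a, R a e).
Proof.
move=> dR; apply: (definable_ext (R := fun e => ~ forall a, ~ R a e)).
  move=> e; rewrite -existsNP; split=> -[a]; first by move/contrapT; exists a.
  by exists a; exact.
apply: definable_not; apply: definable_all; exact: definable_not.
Qed.

(** Substitution of a term in the formula of [X] is replaced by the quantified statement
    [forall x, x = f e -> X x], for which renaming of variables suffices. *)
Lemma definable_mem (V : Type) (X : set M) (f : (V -> M) -> M) :
  (exists phi : formula L ('I_1 + 'I_p),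
     X = [set x | instance phi b (fun=> x)]) ->
  definable_fun f -> definable_rel (fun e => X (f e)).
Proof.
move=> [phi ->] [t tf].
pose R x (e : V -> M) := x = f e -> instance phi b (fun=> x).
apply: (definable_ext (R := fun e => forall x, R x e)).
  by move=> e; split=> [|Xfe x ->//]; exact.
apply: definable_all; apply: definable_imp.
  exists (FEq (TVar (inl None)) (term_rename (fun o => match o with
    | inl v => inl (Some v) | inr i => inr i end) t)) => e /=.
  rewrite teval_rename -tf; suff -> : env_sum e b \o (fun o => match o with
    | inl v => inl (Some v) | inr i => inr i end) =
    env_sum (fun v => e (Some v)) b by [].
  by apply/funext => -[].
exists (formula_rename phi (fun o => match o with
  | inl _ => inl None | inr i => inr i end)) => e.
rewrite holds_rename /instance /=.
suff -> : env_sum e b \o (fun o => match o with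
  | inl _ => inl None | inr i => inr i end) =
  env_sum (fun _ : 'I_1 => e None) b by [].
by apply/funext => -[].
Qed.

(** Inp-patterns are made of formulas without parameters, so the fixed parameters [b] are appended
    to the varying ones. *)
Definition param_cat (q : nat) (a : 'I_q -> M) (i : 'I_(q + p)) : M :=
  match fintype.split i with inl j => a j | inr j => b j end.

Lemma definable_instance (q : nat) (R : M -> ('I_q -> M) -> Prop) :
  definable_rel (fun e => R (e None) (fun i => e (Some i))) ->
  exists phi : formula L ('I_1 + 'I_(q + p)), forall a x,
    instance phi (param_cat a) x <-> R (x ord0) a.
Proof.
move=> [phi H].
pose s (o : option 'I_q + 'I_p) : 'I_1 + 'I_(q + p) :=
  match o with
  | inl None => inl ord0
  | inl (Some i) => inr (lshift p i)
  | inr i => inr (rshift q i)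
  end.
exists (formula_rename phi s) => a x.
rewrite /instance /= holds_rename.
have -> : env_sum x (param_cat a) \o s = env_sum (env_cons (x ord0) a) b.
  apply/funext => -[[i|]|i] //=; rewrite /param_cat.
    by rewrite -[lshift p i]/(unsplit (inl i)) unsplitK.
  by rewrite -[rshift q i]/(unsplit (inr i)) unsplitK.
by rewrite H.
Qed.

End Definability.

(** * Ordered groups *)

Section OrderedGroup.
Local Open Scope group_scope.
Local Open Scope order_scope.
Variables (d : Order.disp_t) (G : orderedGroupType d).
Implicit Types (x y z c e t : G) (i j k n : nat).

Lemma lemg2l z x y : (z * x <= z * y) = (x <= y).
Proof.
apply/idP/idP => [/(le_mulg2l z^-1)|]; first by rewrite !mulKg.
exact: le_mulg2l.
Qed.

Lemma lemg2r z x y : (x * z <= y * z) = (x <= y).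
Proof.
apply/idP/idP => [/(le_mulg2r z^-1)|]; first by rewrite !mulgK.
exact: le_mulg2r.
Qed.

Lemma ltmg2l z x y : (z * x < z * y) = (x < y).
Proof. by rewrite !ltNge lemg2l. Qed.

Lemma ltmg2r z x y : (x * z < y * z) = (x < y).
Proof. by rewrite !ltNge lemg2r. Qed.

Lemma ltVg2 x y : (x^-1 < y^-1) = (y < x).
Proof. by rewrite -(ltmg2l x x^-1) mulgV -(ltmg2r y 1) mulgVK mul1g. Qed.

Lemma leVg2 x y : (x^-1 <= y^-1) = (y <= x).
Proof. by rewrite !leNgt ltVg2. Qed.

Lemma ltVg1 x : (x^-1 < 1) = (1 < x).
Proof. by rewrite -{1}invg1 ltVg2. Qed.

Lemma lt1Vg x : (1 < x^-1) = (x < 1).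
Proof. by rewrite -{1}invg1 ltVg2. Qed.

Lemma ltgM x y z t : x < y -> z < t -> x * z < y * t.
Proof.
by move=> xy zt; apply: (lt_trans (y := y * z)); rewrite ?ltmg2l ?ltmg2r.
Qed.

Lemma legM x y z t : x <= y -> z <= t -> x * z <= y * t.
Proof.
by move=> xy zt; apply: (le_trans (y := y * z)); rewrite ?lemg2l ?lemg2r.
Qed.

Lemma expg_ge1 x n : 1 <= x -> 1 <= x ^+ n.
Proof. by move=> x1; elim: n => // n IHn; rewrite expgS -[1]mulg1 legM. Qed.

Lemma expg_lt1 x n : x < 1 -> (0 < n)%N -> x ^+ n < 1.
Proof.
move=> x1; elim: n => // -[|n] IHn _; first by rewrite expg1.
by rewrite expgS -[1]mulg1 ltgM // IHn.
Qed.

Lemma ltg_exp2 x i j : 1 < x -> (i < j)%N -> x ^+ i < x ^+ j.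
Proof.
move=> x1 ij; rewrite -(subnKC ij) addSnnS expgnDr -[ltLHS]mulg1 ltmg2l.
rewrite expgS -[1]mulg1 (lt_le_trans (y := x * 1)) ?ltmg2r //.
by rewrite lemg2l expg_ge1 // ltW.
Qed.

Lemma leg_exp2 x i j : 1 <= x -> (i <= j)%N -> x ^+ i <= x ^+ j.
Proof.
by move=> x1 ij; rewrite -(subnKC ij) expgnDr -[leLHS]mulg1 lemg2l expg_ge1.
Qed.

(** The minimum of finitely many radii works because [P i] passes to smaller radii; the first
    hypothesis serves the case [N = 0]. *)
Lemma common_radius (P : nat -> G -> Prop) (N : nat) :
  (exists c, 1 < c) ->
  (forall i c c', 1 < c' -> c' <= c -> P i c -> P i c') ->
  (forall i, (i < N)%N -> exists c, 1 < c /\ P i c) ->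
  exists c, 1 < c /\ forall i, (i < N)%N -> P i c.
Proof.
move=> [u u1] Pd; elim: N => [|N IHN] PN; first by exists u.
have [i iN|c [c1 cP]] := IHN; first by apply: PN; exact: ltnW.
have [c' [c'1 c'P]] := PN N (ltnSn N).
exists (Order.min c c'); split=> [|i]; first by rewrite lt_min c1.
have m1 : 1 < Order.min c c' by rewrite lt_min c1.
rewrite ltnS leq_eqVlt => /orP[/eqP->|iN].
  by apply: Pd c'P; rewrite // ge_min lexx orbT.
by apply: Pd (cP i iN); rewrite // ge_min lexx.
Qed.

(** The sets [W e] grow as [e] decreases; together they exhaust every [F i], but none of them
    contains any [F i]. Below each radius there is thus a smaller one that captures new points of
    all the [F i] at once. The differences of successive [W (e j)] are disjoint and will serve as a
    row of an inp-pattern. *)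
Lemma filtration (W : G -> G -> Prop) (F : nat -> G -> Prop) (N : nat) :
  (exists c, 1 < c) ->
  (forall e e' z, 1 < e' -> e' <= e -> W e z -> W e' z) ->
  (forall i e, (i < N)%N -> 1 < e -> exists z, F i z /\ ~ W e z) ->
  (forall z, (exists2 i, (i < N)%N & F i z) -> exists e, 1 < e /\ W e z) ->
  exists e : nat -> G, [/\ forall i, 1 < e i,
    forall i j, (i <= j)%N -> e j <= e i &
    forall i j, (i < N)%N -> exists z, [/\ F i z, W (e j.+1) z & ~ W (e j) z]].
Proof.
move=> ex1 Wd Fex FW.
have /choice [f fP] : forall e, exists e', 1 < e -> [/\ 1 < e', e' <= e &
    forall i, (i < N)%N -> exists z, [/\ F i z, W e' z & ~ W e z]].
  move=> e; have [e1|] := pselect (1 < e); last by exists e.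
  pose P i e' := exists z, [/\ F i z, W e' z & ~ W e z].
  have [|i iN|e' [e'1 e'P]] := @common_radius P N ex1.
  - move=> i c c' c'1 cc' [z [Fz Wz nWz]]; exists z; split=> //.
    exact: Wd Wz.
  - have [z [Fz nWz]] := Fex i e iN e1.
    have [|e' [e'1 We']] := FW z; first by exists i.
    by exists e'; split=> //; exists z.
  exists (Order.min e e') => _.
  have m1 : 1 < Order.min e e' by rewrite lt_min e1.
  split=> // [|i iN]; first by rewrite ge_min lexx.
  have [z [Fz Wz nWz]] := e'P i iN; exists z; split=> //.
  by apply: Wd Wz; rewrite // ge_min lexx orbT.
have [u u1] := ex1.
pose e n := iter n f u.
have e1 n : 1 < e n by elim: n => //= n /fP[].
exists e; split=> // [i j|i j iN].
  move=> /subnKC <-; elim: (j - i)%N => [|m IHm]; first by rewrite addn0.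
  by rewrite addnS; apply: le_trans IHm; have [] := fP _ (e1 (i + m)%N).
by have [_ _ /(_ i iN)] := fP _ (e1 j).
Qed.

End OrderedGroup.

(** * Inp-minimality for definable families in an ordered group *)

Section DefinableFamilies.
Local Open Scope group_scope.
Local Open Scope order_scope.
Variables (d : Order.disp_t) (G : orderedGroupType d) (L : language)
  (S : interp L G) (p : nat) (b : 'I_p -> G).
Let M := og_structure S.

Lemma definable_mulg (V : Type) (f g : (V -> G) -> G) :
  definable_fun (M := M) b f -> definable_fun (M := M) b g ->
  definable_fun (M := M) b (fun e => f e * g e).
Proof.
move=> [t tf] [u ug].
exists (@TApp (og_language L) _ 2 (inl og_mul)
         (fun i => if i == ord0 then t else u)) => e /=.
by rewrite tf ug.
Qed.

Lemma definable_invg (V : Type) (f : (V -> G) -> G) :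
  definable_fun (M := M) b f -> definable_fun (M := M) b (fun e => (f e)^-1).
Proof.
move=> [t tf].
exists (@TApp (og_language L) _ 1 (inl og_inv) (fun=> t)) => e /=.
by rewrite tf.
Qed.

Lemma definable_oneg (V : Type) :
  definable_fun (M := M) b (fun _ : V -> G => 1).
Proof.
have ts : 'I_0 -> term (og_language L) (V + 'I_p) by case.
by exists (@TApp (og_language L) _ 0 (inl og_one) ts).
Qed.

Lemma definable_ltg (V : Type) (f g : (V -> G) -> G) :
  definable_fun (M := M) b f -> definable_fun (M := M) b g ->
  definable_rel (M := M) b (fun e => f e < g e).
Proof.
move=> [t tf] [u ug].
exists (@FRel (og_language L) _ 2 (inl og_lt)
         (fun i => if i == ord0 then t else u)) => e /=.
by rewrite tf ug.
Qed.

Lemma definable_andb (V : Type) (R R' : (V -> G) -> bool) :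
  definable_rel (M := M) b (fun e => R e) ->
  definable_rel (M := M) b (fun e => R' e) ->
  definable_rel (M := M) b (fun e => R e && R' e).
Proof.
move=> dR dR'; apply: (definable_ext (M := M) (R := fun e => R e /\ R' e)).
  by move=> e; split=> /andP.
exact: definable_and.
Qed.

(** The patterns below take at most three varying parameters per formula; shorter tuples are padded
    with [1]. *)
Definition definable_family (R : G -> G -> G -> G -> Prop) : Prop :=
  definable_rel (M := M) b (fun e : option 'I_3 -> G =>
    R (e None) (e (Some (@Ordinal 3 0 isT))) (e (Some (@Ordinal 3 1 isT)))
      (e (Some (@Ordinal 3 2 isT)))).

Lemma no_inp_pattern (R R' : G -> G -> G -> G -> Prop) (k : nat) :
  inp_minimal (complete_theory M) -> (0 < k)%N ->
  definable_family R -> definable_family R' ->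
  (forall N, exists x y w x' y' w' : nat -> G,
    [/\ forall g, set_inj `I_k g -> (forall i, (i < k)%N -> (g i < N)%N) ->
          ~ exists z, forall i, (i < k)%N -> R z (x (g i)) (y (g i)) (w (g i)),
        forall i j z, (i < j < N)%N -> R' z (x' i) (y' i) (w' i) ->
          R' z (x' j) (y' j) (w' j) -> False
      & forall i j, (i < N)%N -> (j < N)%N ->
          exists z, R z (x i) (y i) (w i) /\ R' z (x' j) (y' j) (w' j)]) ->
  False.
Proof.
move=> minM k0 dR dR' H.
pose fam (Q : G -> G -> G -> G -> Prop) (z : G) (a : 'I_3 -> G) :=
  Q z (a (@Ordinal 3 0 isT)) (a (@Ordinal 3 1 isT)) (a (@Ordinal 3 2 isT)).
have [phi phiP] := definable_instance (M := M) (R := fam R) dR.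
have [psi psiP] := definable_instance (M := M) (R := fam R') dR'.
pose vec (x y w : G) (i : 'I_3) := nth 1 [:: x; y; w] i.
apply: (finite_inp_arrays (phi := phi) (psi := psi) minM k0 (isT : (0 < 2)%N)).
move=> N; have [x [y [w [x' [y' [w' [H1 H2 H3]]]]]]] := H N.
exists (fun i => param_cat (M := M) b (vec (x i) (y i) (w i))),
  (fun i => param_cat (M := M) b (vec (x' i) (y' i) (w' i))); split.
- move=> g ginj gN [z zP]; apply: (H1 g ginj gN).
  by exists (z ord0) => i /zP/phiP.
- move=> g ginj gN [z zP].
  have /psiP z0 := zP 0%N isT; have /psiP z1 := zP 1%N isT.
  case: (ltngtP (g 0%N) (g 1%N)) => g01.
  + by apply: H2 z0 z1; rewrite g01 gN.
  + by apply: H2 z1 z0; rewrite g01 gN.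
  + by have /(_ _ _) := ginj 0%N 1%N; rewrite !inE => /(_ isT isT g01).
- move=> i j iN jN; have [z [z1 z2]] := H3 i j iN jN.
  by exists (fun=> z); split; [apply/phiP|apply/psiP].
Qed.

Lemma no_inp_pattern2 (R R' : G -> G -> G -> G -> Prop) :
  inp_minimal (complete_theory M) ->
  definable_family R -> definable_family R' ->
  (forall N, exists x y w x' y' w' : nat -> G,
    [/\ forall i j z, (i < j < N)%N -> R z (x i) (y i) (w i) ->
          R z (x j) (y j) (w j) -> False,
        forall i j z, (i < j < N)%N -> R' z (x' i) (y' i) (w' i) ->
          R' z (x' j) (y' j) (w' j) -> False
      & forall i j, (i < N)%N -> (j < N)%N ->
          exists z, R z (x i) (y i) (w i) /\ R' z (x' j) (y' j) (w' j)]) ->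
  False.
Proof.
move=> minM dR dR' H; apply: (no_inp_pattern (k := 2) minM isT dR dR') => N.
have [x [y [w [x' [y' [w' [H1 H2 H3]]]]]]] := H N.
exists x, y, w, x', y', w'; split=> // g ginj gN [z zP].
have z0 := zP 0%N isT; have z1 := zP 1%N isT.
case: (ltngtP (g 0%N) (g 1%N)) => g01.
- by apply: H1 z0 z1; rewrite g01 gN.
- by apply: H1 z1 z0; rewrite g01 gN.
- by have /(_ _ _) := ginj 0%N 1%N; rewrite !inE => /(_ isT isT g01).
Qed.

End DefinableFamilies.

Ltac definability mem :=
  repeat first
    [ apply: mem
    | apply: definable_andb | apply: definable_ltg
    | apply: definable_iff | apply: definable_and | apply: definable_not
    | apply: definable_imp | apply: definable_eq
    | apply: definable_all | apply: definable_ex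
    | apply: definable_mulg | apply: definable_invg | apply: definable_oneg
    | apply: definable_var ].

(** * Balls around 1, roots and separation of points *)

Section Neighborhoods.
Local Open Scope group_scope.
Local Open Scope order_scope.
Variables (d : Order.disp_t) (G : orderedGroupType d).
Implicit Types (x y z c s t u : G).

(** As [c] decreases, the left translates [x * ball c], written [ball c (x^-1 * z)], serve as
    neighbourhoods of [x]. *)
Definition ball c : set G := [set t | c^-1 < t < c].

Lemma ball_le c c' : c' <= c -> ball c' `<=` ball c.
Proof.
move=> cc' t /andP[c't tc']; apply/andP; split.
  by apply: le_lt_trans c't; rewrite leVg2.
exact: lt_le_trans cc'.
Qed.

Lemma ball_ge1 c t : 1 <= t -> t < c -> ball c t.
Proof.
move=> t1 tc; apply/andP; split=> //; apply: (lt_le_trans _ t1).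
by rewrite ltVg1; apply: le_lt_trans tc.
Qed.

Lemma ball1 c : 1 < c -> ball c 1.
Proof. by move=> c1; apply: ball_ge1. Qed.

Lemma ballV c t : ball c t -> ball c t^-1.
Proof.
by move=> /andP[ct tc]; rewrite /ball/= ltVg2 tc -[ltRHS]invgK ltVg2.
Qed.

Lemma ballM c s t : ball c s -> ball c t -> ball (c * c) (s * t).
Proof.
move=> /andP[cs sc] /andP[ct tc].
by rewrite /ball/= invgM !ltgM.
Qed.

Lemma ball_open c t :
  ball c t -> exists c', 1 < c' /\ forall u, ball c' u -> ball c (t * u).
Proof.
(* The group may be non-commutative: [t * u < c] bounds [u] by [t^-1 * c], while [c^-1 < t * u]
   bounds [u^-1] by [c * t]. *)
move=> /andP[ct tc]; exists (Order.min (t^-1 * c) (c * t)); split.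
  by rewrite lt_min -(ltmg2l t) mulg1 mulVKg tc -(ltmg2l c^-1) mulg1 mulKg.
move=> u /andP[mu]; rewrite lt_min => /andP[u1 _]; apply/andP; split.
  rewrite -(ltmg2l t^-1) mulKg -invgM; apply: le_lt_trans mu.
  by rewrite leVg2 ge_min lexx orbT.
by rewrite -(ltmg2l t^-1) mulKg.
Qed.

Lemma not_ball z : z <> 1 -> exists c, 1 < c /\ ~ ball c z.
Proof.
move=> /eqP; rewrite neq_lt => /orP[z1|z1]; last first.
  by exists z; split=> // /andP[_]; rewrite ltxx.
exists z^-1; rewrite lt1Vg; split=> // /andP[].
by rewrite invgK ltxx.
Qed.

Hypothesis divG : divisible G.

Lemma root_gt1 c n : 1 < c -> (0 < n)%N -> exists s, 1 < s /\ s ^+ n = c.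
Proof.
move=> c1 n0; have [s sn] := divG n0 c; exists s; split=> //.
rewrite ltNge; apply/negP; rewrite le_eqVlt => /orP[/eqP s1|/expg_lt1/(_ n0)].
  by move: c1; rewrite -sn s1 expg1n ltxx.
by rewrite sn ltNge (ltW c1).
Qed.

Lemma sqrt_gt1 c : 1 < c -> exists s, 1 < s /\ s * s = c.
Proof. by move=> c1; have [s] := root_gt1 c1 (isT : (0 < 2)%N); exists s. Qed.

(** A point close to both [x] and [y] would exhibit [x^-1 * y] as a product of two elements of
    [ball c], where [c * c] is a radius excluding [x^-1 * y]. *)
Lemma separate_points x y :
  x <> y -> exists c, 1 < c /\
    forall z, ball c (x^-1 * z) -> ball c (y^-1 * z) -> False.
Proof.
move=> xy; have : x^-1 * y <> 1.
  by move=> h; apply: xy; rewrite -[y](mulVKg x) h mulg1.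
move=> /not_ball[e [e1 ne]]; have [c [c1 ce]] := sqrt_gt1 e1.
exists c; split=> // z zx zy; apply: ne; rewrite -ce.
have -> : x^-1 * y = (x^-1 * z) * (y^-1 * z)^-1 by rewrite mulgKA invgK.
by apply: ballM => //; apply: ballV.
Qed.

Lemma separate_sequence (h : nat -> G) N :
  (exists c, 1 < c) -> injective h ->
  exists c, 1 < c /\ forall i j z, (i < j < N)%N ->
    ball c ((h i)^-1 * z) -> ball c ((h j)^-1 * z) -> False.
Proof.
move=> ex1 hinj.
pose P i j c := (i < j)%N -> forall z,
  ball c ((h i)^-1 * z) -> ball c ((h j)^-1 * z) -> False.
have [|j jN|c [c1 cP]] := @common_radius _ _
    (fun j c => forall i, (i < N)%N -> P i j c) N ex1.
- move=> j c c' _ c'c jP i iN ij z zi zj.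
  by apply: (jP i iN ij z); apply: ball_le c'c _ _.
- apply: (@common_radius _ _ (P^~ j) N ex1).
    move=> i c c' _ c'c iP ij z zi zj.
    by apply: (iP ij z); apply: ball_le c'c _ _.
  move=> i iN; have [ij|/negP nij] := boolP (i < j)%N; last first.
    by have [c c1] := ex1; exists c; split=> // ij; case: nij.
  have [|c [c1 cP]] := @separate_points (h i) (h j).
    by move=> /hinj ij'; rewrite ij' ltnn in ij.
  by exists c; split=> // _; exact: cP.
exists c; split=> // i j z /andP[ij jN] zi zj.
exact: (cP j jN i (ltn_trans ij jN) ij z).
Qed.

End Neighborhoods.

Lemma infinite_set_seq (T : Type) (X : set T) :
  infinite_set X -> exists h : nat -> T, (forall i, X (h i)) /\ injective h.
Proof.
elim/Ppointed: T => T in X *; first by rewrite emptyE.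
move=> /infiniteP/pcard_leP[f]; exists f; split=> [i|i j ij]; first exact: funS.
by apply: (@inj _ _ _ f) => //; rewrite inE.
Qed.

(** * Dp-minimal ordered groups *)

Section DpMinimal.
Local Open Scope group_scope.
Local Open Scope order_scope.
Variables (d : Order.disp_t) (G : orderedGroupType d) (L : language)
  (S : interp L G).
Let M := og_structure S.
Let T := complete_theory M.
Hypotheses (divG : divisible G) (minG : inp_minimal T).
Hypothesis gt1_ex : exists c : G, 1 < c.

Lemma definable_memg (X : set G) : definable (M := M) X ->
  exists p (b : 'I_p -> G), forall V (f : (V -> G) -> G),
    definable_fun (M := M) b f -> definable_rel (M := M) b (fun e => X (f e)).
Proof.
move=> [p [phi [b Xb]]]; exists p, b => V f; apply: definable_mem.
by exists phi.
Qed.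

(** In an infinite discrete [X], finitely many points have a common isolation radius [c0]. The right
    translates by small powers of [s] of the [c0]-isolated points are pairwise disjoint, and each of
    them meets the disjoint neighbourhoods of the points [h i]. *)
Lemma definable_isolated_finite (X : set G) : definable (M := M) X ->
  (forall x, X x ->
     exists c, 1 < c /\ forall t, ball c t -> X (x * t) -> t = 1) ->
  finite_set X.
Proof.
move=> /definable_memg[p [b memX]] isoX; apply: contrapT => Xinf.
have [h [Xh hinj]] := infinite_set_seq Xinf.
pose R (z u v w : G) := ball v (u^-1 * z).
pose R' (z u v w : G) := X (z * u^-1) /\
  forall t, ball v t -> X (z * u^-1 * t) -> t = 1.
apply: (no_inp_pattern2 (S := S) (b := b) (R := R) (R' := R') minG).
- by rewrite /definable_family /R /ball/=; definability memX.
- by rewrite /definable_family /R' /ball/=; definability memX.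
move=> N.
have [|i iN|c0 [c01 c0P]] := @common_radius _ _
  (fun i c => forall t, ball c t -> X (h i * t) -> t = 1) N gt1_ex.
- by move=> i c c' _ c'c iP t /(ball_le c'c)/iP.
- exact: isoX.
have [c [c1 cc]] := sqrt_gt1 divG c01.
(* The powers [s ^+ i] with [i < N] stay in [ball c]; the exponent [N.+1] is positive even for
   [N = 0]. *)
have [s [s1 sc]] := root_gt1 divG c1 (ltn0Sn N).
have cc0 : c <= c0 by rewrite -cc -[leLHS]mulg1 lemg2l ltW.
have ball_s i : (i < N)%N -> ball c (s ^+ i).
  move=> iN; apply: ball_ge1; first by rewrite expg_ge1 // ltW.
  by rewrite -sc ltg_exp2 // ltnW.
exists h, (fun=> c), (fun=> 1), (fun i => s ^+ i), (fun=> c0), (fun=> 1); split.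
- move=> i j z /andP[ij jN] zi zj.
  have : (h i)^-1 * h j = 1.
    apply: (c0P i (ltn_trans ij jN)); last by rewrite mulVKg.
    have -> : (h i)^-1 * h j = ((h i)^-1 * z) * ((h j)^-1 * z)^-1.
      by rewrite mulgKA invgK.
    by rewrite -cc; apply: ballM => //; apply: ballV.
  move=> hij; have /hinj ij' : h j = h i.
    by rewrite -[h j](mulVKg (h i)) hij mulg1.
  by rewrite ij' ltnn in ij.
- move=> i j z /andP[ij jN] [Xi isoi] [Xj _].
  have E : s ^+ j = s ^+ (j - i) * s ^+ i by rewrite -expgnDr subnK // ltnW.
  have : (s ^+ (j - i))^-1 = 1.
    apply: isoi; last by rewrite -mulgA -invgM -E.
    apply: (ball_le cc0); apply: ballV; apply: ball_s.
    exact: leq_ltn_trans (leq_subr i j) jN.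
  move=> /eqP; rewrite invg_eq1 => /eqP sji.
  have := ltg_exp2 (i := 0) (j := j - i) s1; rewrite subn_gt0 => /(_ ij).
  by rewrite expg0 sji ltxx.
move=> i j iN jN; exists (h i * s ^+ j); split.
  by rewrite /R mulKg; apply: ball_s.
by rewrite /R' mulgK; split=> // t; exact: c0P.
Qed.

(** * Germs at 1 of the translates [x^-1 * X] *)

Definition germ_eq (X : set G) (x y : G) : Prop :=
  exists c, 1 < c /\ forall t, ball c t -> (X (x * t) <-> X (y * t)).

Lemma germ_eq_sym X x y : germ_eq X x y -> germ_eq X y x.
Proof. by move=> [c [c1 cP]]; exists c; split=> // t /cP ->. Qed.

Lemma germ_eq_trans X x y z : germ_eq X x y -> germ_eq X y z -> germ_eq X x z.
Proof.
move=> [c [c1 cP]] [c' [c'1 c'P]]; exists (Order.min c c').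
rewrite lt_min c1; split=> // t ct; rewrite cP ?c'P //.
  by apply: ball_le ct; rewrite ge_min lexx orbT.
by apply: ball_le ct; rewrite ge_min lexx.
Qed.

(** Balls are open, so equality of germs spreads to nearby points. It follows that a germ class has
    the same germ, as a set in its own right, at all its points. *)
Lemma germ_eq_open X x y : germ_eq X x y -> exists c, 1 < c /\
  forall t, ball c t -> (X (x * t) <-> X (y * t)) /\ germ_eq X (x * t) (y * t).
Proof.
move=> [c [c1 cP]]; exists c; split=> // t ct; split; first exact: cP.
have [c' [c'1 c'P]] := ball_open ct.
by exists c'; split=> // u /c'P; rewrite -!mulgA => /cP.
Qed.

(* Given infinitely many germs, NIP and Ramsey yield pairs of points whose
   germs are separated by k-inconsistent sets; all of them meet every
   neighbourhood of the identity, and thus each of a sequence of shells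
   around it. *)
Lemma finite_germs (X : set G) (a : nat -> G) : NIP T -> definable (M := M) X ->
  (forall i, X (a i)) -> ~ (forall i j, (i < j)%N -> ~ germ_eq X (a i) (a j)).
Proof.
move=> nipG /definable_memg[p [b memX]] Xa nE.
pose P x i := X (a i * x).
have [k [h [hh hk]]] : exists k h, {homo h : i j / (i < j)%N} /\
    forall g, set_inj `I_k g -> ~ exists x, forall i, (i < k)%N ->
      separates P x (h (g i).*2) (h (g i).*2.+1).
  (* Otherwise the second alternative of [ramsey_separation] holds for every [k], and shattered sets
     of every finite size contradict NIP. *)
  apply: contrapT => nk.
  pose R x (v : 'I_1 -> G) := X (x * v ord0).
  have [|phi phiP] := definable_instance (M := M) (b := b) (R := R).
    by rewrite /R; definability memX.
  apply: (finite_NIP_arrays (phi := phi) nipG) => k.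
  have [[h hP]|[c cP]] := ramsey_separation P k.
    by case: nk; exists k, h.
  exists (fun i => fun=> a (c i)) => Z; have [x xP] := cP Z.
  by exists (param_cat (M := M) b (fun=> x)) => i /xP <-; rewrite phiP.
have k0 : (0 < k)%N.
  rewrite lt0n; apply/eqP => k0; apply: (hk id); first by move=> i j _ _.
  by exists 1 => i; rewrite k0.
pose R (z u v w : G) := ~ (X (u * z) <-> X (v * z)).
pose R' (z u v w : G) := ~ ball v z /\ ball u z.
apply: (no_inp_pattern (S := S) (b := b) (R := R) (R' := R') minG k0).
- by rewrite /definable_family /R; definability memX.
- by rewrite /definable_family /R' /ball/=; definability memX.
move=> N.
pose F i z := R z (a (h i.*2)) (a (h i.*2.+1)) 1.
(* The shells are differences of nested balls. [F i] meets every ball because the two germs differ,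
   and it omits [1] because every [a i] lies in [X], so each of its points leaves some ball. *)
have [||z [i iN Fz]|e [e1 ed eP]] :=
  @filtration _ G (fun e z => ~ ball e z) F N gt1_ex.
- by move=> e e' z _ e'e nz /(ball_le e'e).
- move=> i e _ ei; apply: contrapT => nF.
  apply: (nE (h i.*2) (h i.*2.+1)); first exact: hh.
  exists e; split=> // t et; apply: contrapT => nt.
  by apply: nF; exists t; split=> // /(_ et).
- apply: not_ball => z1; apply: Fz; rewrite z1 !mulg1.
  by split=> _; exact: Xa.
exists (fun i => a (h i.*2)), (fun i => a (h i.*2.+1)), (fun=> 1).
exists e, (fun i => e i.+1), (fun=> 1); split.
- move=> g ginj _ [z zP]; apply: (hk g ginj).
  by exists z => i /zP.
- by move=> i j z /andP[ij _] [ni _] [_ /(ball_le (ed _ _ ij))].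
move=> i j iN jN; have [z [Fz nz /contrapT bz]] := eP i j iN.
by exists z.
Qed.

Definition homogeneous (X : set G) : Prop :=
  forall x y, X x -> X y -> germ_eq X x y.

(** Some germ class in [X] is infinite: if all were finite, a greedy choice would give a sequence of
    pairwise different germs, against [finite_germs]. *)
Lemma homogeneous_subset (X : set G) : NIP T -> definable (M := M) X ->
  infinite_set X -> exists Y, [/\ Y `<=` X, definable (M := M) Y,
    infinite_set Y & homogeneous Y].
Proof.
move=> nipG defX Xinf.
pose Y y := [set x | X x /\ germ_eq X x y].
have [y Xy Yinf] : exists2 y, X y & infinite_set (Y y).
  apply: contrapT => nY.
  have Yfin y : X y -> finite_set (Y y).
    by move=> Xy; apply: contrapT => Yinf; apply: nY; exists y.
  (* The premise that [s] lies in [X] makes the condition satisfiable for every list; it is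
     discharged afterwards by strong induction. *)
  have [s|a aP] := @greedy_sequence G (fun s x => (forall y, y \in s -> X y) ->
      X x /\ forall y, y \in s -> ~ germ_eq X x y).
    have [sX|nsX] := pselect (forall y, y \in s -> X y); last by exists 1.
    pose D := \bigcup_(y in [set` s]) Y y.
    have Dfin : finite_set D by apply: bigcup_finite => // y ys; exact/Yfin/sX.
    have [x [Xx nDx]] := infinite_setN0 (infinite_setD Xinf Dfin).
    exists x => _; split=> // y ys xy; apply: nDx.
    by exists y.
  have Xa n : X (a n).
    elim/ltn_ind: n => n IH; apply: (aP n _).1 => y.
    by move=> /mapP[i]; rewrite mem_iota => /= /IH Xi ->.
  apply: (finite_germs nipG defX Xa) => i j ij /germ_eq_sym.
  apply: (aP j _).2; last by apply/mapP; exists i; rewrite ?mem_iota.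
  by move=> y /mapP[m _ ->].
exists (Y y); split=> //; first by move=> x [].
  have [p [b memX]] := definable_memg defX.
  pose R (x : G) (v : 'I_1 -> G) := X x /\ exists c, 1 < c /\
    forall t, ball c t -> (X (x * t) <-> X (v ord0 * t)).
  have [|phi phiP] := definable_instance (M := M) (b := b) (R := R).
    by rewrite /R /ball/=; definability memX.
  exists (1 + p)%N, phi, (param_cat (M := M) b (fun=> y)).
  by apply/seteqP; split=> x; rewrite /mkset phiP.
move=> x x' [Xx xy] [Xx' x'y].
have xx' := germ_eq_trans xy (germ_eq_sym x'y).
have [c [c1 cP]] := germ_eq_open xx'; exists c; split=> // t /cP[XX E].
split=> -[Xt Et]; split; try by apply/XX.
  exact: germ_eq_trans (germ_eq_sym E) Et.
exact: germ_eq_trans E Et.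
Qed.

(* Otherwise the radii of the balls on which the germs of the points of X agree
   with a fixed one accumulate at 1 near each point of X, and the sets of points
   with radius between two given bounds form a row of a pattern. *)
Lemma locally_uniform_radius (X : set G) : definable (M := M) X ->
  infinite_set X -> homogeneous X ->
  exists x c, [/\ X x, 1 < c & forall u, ball c u -> X (x * u) ->
    forall t, ball c t -> (X (x * u * t) <-> X (x * t))].
Proof.
move=> /definable_memg[p [b memX]] Xinf homX; apply: contrapT => nX.
have [h [Xh hinj]] := infinite_set_seq Xinf.
pose W (r e z : G) := X z /\ forall t, ball e t -> (X (z * t) <-> X (r * t)).
pose R (z u v w : G) := ball v (u^-1 * z).
pose R' (z u v w : G) := X z /\ W w v z /\ ~ W w u z.
apply: (no_inp_pattern2 (S := S) (b := b) (R := R) (R' := R') minG).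
- by rewrite /definable_family /R /ball/=; definability memX.
- by rewrite /definable_family /R' /W /ball/=; definability memX.
move=> N.
have [c [c1 sepc]] := separate_sequence divG N gt1_ex hinj.
pose F i z := ball c ((h i)^-1 * z) /\ X z.
have Wd r e e' z : e' <= e -> W r e z -> W r e' z.
  by move=> e'e [Xz We]; split=> // t /(ball_le e'e)/We.
have [e e' z _|i e iN e1|z [i _ [_ Xz]]|e [e1 ed eP]] :=
  @filtration _ G (W (h 0%N)) F N gt1_ex.
- exact: Wd.
(* If all points of [F i] had radius [e], the claim would hold at [h i] with radius [min c e]: the
   germs at [h i * u] and at [h i] both agree with the reference germ at [h 0]. *)
- apply: contrapT => nF.
  have FW u : ball c u -> X (h i * u) -> W (h 0%N) e (h i * u).
    move=> cu Xu; apply: contrapT => nW; apply: nF; exists (h i * u).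
    by rewrite /F mulKg.
  apply: nX; exists (h i), (Order.min c e); split=> //.
    by rewrite lt_min c1.
  move=> u cu Xu t ct.
  have et : ball e t by apply: ball_le ct; rewrite ge_min lexx orbT.
  have [_ Wu] : W (h 0%N) e (h i * u).
    by apply: FW => //; apply: ball_le cu; rewrite ge_min lexx.
  have [_ W1] : W (h 0%N) e (h i * 1).
    by apply: FW; [exact: ball1|rewrite mulg1].
  by rewrite (Wu t et) -(W1 t et) mulg1.
- have [e [e1 eP]] := homX z (h 0%N) Xz (Xh 0%N).
  by exists e; split.
exists h, (fun=> c), (fun=> 1), e, (fun i => e i.+1), (fun=> h 0%N); split.
- exact: sepc.
- by move=> i j z /andP[ij _] [_ [Wi _]] [_ [_ []]]; apply: Wd Wi; exact: ed.
move=> i j iN jN; have [z [[cz Xz] Wz nWz]] := eP i j iN.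
by exists z.
Qed.

(** The local subgroup [H] consists of the [t] in [ball c] with [X (x * t)]; [loc] makes it closed
    under inverses, and under products that stay in [ball c]. The rows are neighbourhoods of points
    [h i] of [H] and right cosets of [H] by powers of [s]; [h i * s ^+ j] lies in both. *)
Lemma homogeneous_interior (X : set G) : definable (M := M) X ->
  infinite_set X -> homogeneous X ->
  exists x c, 1 < c /\ forall t, ball c t -> X (x * t).
Proof.
move=> defX Xinf homX; apply: contrapT => noint.
have [x [c [Xx c1 loc]]] := locally_uniform_radius defX Xinf homX.
(* If [x] were isolated, homogeneity would make every point isolated and [X] finite. *)
have nonisolated e : 1 < e -> exists t, [/\ ball e t, X (x * t) & t <> 1].
  move=> e1; apply: contrapT => iso; apply: Xinf.
  apply: definable_isolated_finite => // y Xy.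
  have [c' [c'1 c'P]] := homX y x Xy Xx.
  exists (Order.min e c'); rewrite lt_min e1; split=> // t et Xt.
  apply: contrapT => t1; apply: iso; exists t; split=> //.
    by apply: ball_le et; rewrite ge_min lexx.
  by apply/c'P=> //; apply: ball_le et; rewrite ge_min lexx orbT.
have Xinv t : ball c t -> X (x * t) -> X (x * t^-1).
  by move=> ct Xt; rewrite -(loc t ct Xt) ?mulgK //; exact: ballV.
(* Distinct points of [H]: each new one is different from 1 and lies in a ball that avoids the
   earlier points other than 1. *)
have [s|h hP] := @greedy_sequence G
    (fun s u => [/\ ball c u, X (x * u) & u \notin s]).
  have [|i il|e [e1 eP]] := @common_radius _ G
      (fun i e => nth 1 s i <> 1 -> ~ ball e (nth 1 s i)) (size s) gt1_ex.
  - by move=> i e e' _ e'e nb n1 /(ball_le e'e); exact: nb.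
  - have [->|/not_ball[e [e1 ne]]] := pselect (nth 1 s i = 1).
      by have [e e1] := gt1_ex; exists e.
    by exists e.
  have [|t [et Xt t1]] := nonisolated (Order.min c e).
    by rewrite lt_min c1.
  exists t; split=> //; first by apply: ball_le et; rewrite ge_min lexx.
  apply/negP => ts; apply: (eP (index t s)); rewrite ?index_mem ?nth_index //.
  by apply: ball_le et; rewrite ge_min lexx orbT.
have hinj : injective h.
  have H i j : (i < j)%N -> h i <> h j.
    move=> ij hij; have [_ _ /negP[]] := hP j.
    by rewrite -hij; apply/mapP; exists i; rewrite ?mem_iota.
  by move=> i j hij; case: (ltngtP i j) => // /H []; rewrite hij.
have [p [b memX]] := definable_memg defX.
pose R (z u v w : G) := ball v (u^-1 * z).
pose R' (z u v w : G) := ball v (z * u^-1) /\ X (w * (z * u^-1)).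
apply: (no_inp_pattern2 (S := S) (b := b) (R := R) (R' := R') minG).
- by rewrite /definable_family /R /ball/=; definability memX.
- by rewrite /definable_family /R' /ball/=; definability memX.
move=> N.
have [c' [c'1 sep]] := separate_sequence divG N gt1_ex hinj.
pose e := Order.min c c'.
have [ec ec'] : e <= c /\ e <= c' by rewrite !ge_min !lexx orbT.
have e1 : 1 < e by rewrite lt_min c1.
have [t [te t1 nXt]] : exists t, [/\ t < e, 1 < t & ~ X (x * t)].
  have [t [et nXt]] : exists t, ball e t /\ ~ X (x * t).
    apply: contrapT => H; apply: noint; exists x, e; split=> // t et.
    by apply: contrapT => nXt; apply: H; exists t.
  case: (ltgtP t 1) => t1.
  - exists t^-1; rewrite lt1Vg; split=> //; first by case/andP: (ballV et).
    move=> /Xinv; rewrite invgK => H; apply: nXt; apply: H.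
    by apply: ballV; apply: ball_le et.
  - by exists t; split=> //; case/andP: et.
  - by case: nXt; rewrite t1 mulg1.
(* Every [i] with [0 < i < N] divides [N!], so [t] is a power of [s ^+ i], and [s ^+ i] in [H] would
   force [t] into [H]. *)
have [s [s1 st]] := root_gt1 divG t1 (fact_gt0 N).
have ball_s i : (i <= N`!)%N -> ball e (s ^+ i).
  move=> iN; apply: ball_ge1; first by rewrite expg_ge1 // ltW.
  by apply: le_lt_trans te; rewrite -st leg_exp2 // ltW.
have nXs i : (0 < i)%N -> (i < N)%N -> ~ X (x * s ^+ i).
  move=> i0 iN Xs; apply: nXt; rewrite -st.
  have /divnK <- : (i %| N`!)%N by rewrite dvdn_fact // i0 ltnW.
  (* This bound is carried through the induction to keep the partial powers inside [ball c], where
     [loc] applies. *)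
  have : (N`! %/ i * i <= N`!)%N by exact: leq_trunc_div.
  elim: (N`! %/ i)%N => [|m IHm] mN; first by rewrite mulg1.
  have mN' : (m * i <= N`!)%N.
    by apply: leq_trans mN; rewrite leq_mul2r leqnSn orbT.
  rewrite mulSn expgnDr mulgA; apply/loc => //.
  - apply: (ball_le ec); apply: ball_s; apply: leq_trans mN.
    by rewrite mulSn leq_addr.
  - by apply: (ball_le ec); apply: ball_s.
  - exact: IHm.
have N_fact i : (i < N)%N -> (i <= N`!)%N.
  by move=> iN; apply: leq_trans (ltnW iN) _; apply: dvdn_leq (fact_gt0 N) _;
    apply: dvdn_fact; rewrite leqnn andbT (leq_ltn_trans _ iN).
exists h, (fun=> e), (fun=> 1), (fun i => s ^+ i), (fun=> c), (fun=> x); split.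
- move=> i j z ijN zi zj.
  by apply: (sep i j z ijN); apply: (ball_le ec').
- move=> i j z /andP[ij jN] [ci Xi] [cj Xj].
  apply: (nXs (j - i)%N); first by rewrite subn_gt0.
    exact: leq_ltn_trans (leq_subr i j) jN.
  (* A common point [z] of two cosets makes this quotient of elements of [H] an element of [H],
     against [nXs]. *)
  have -> : s ^+ (j - i) = (z * s ^- j)^-1 * (z * s ^- i).
    by rewrite invgM invgK -mulgA mulKg expgnFr // ltnW.
  rewrite mulgA; apply/loc => //; first exact: ballV.
  exact: Xinv.
move=> i j iN jN; exists (h i * s ^+ j); have [ch Xhi _] := hP i.
rewrite /R /R' mulKg mulgK; split=> //.
by apply: ball_s; exact: N_fact.
Qed.

End DpMinimal.

Theorem theorem3p6 (d : Order.disp_t) (G : orderedGroupType d)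
    (L : language) (S : interp L G) (X : set G) :
  divisible G ->
  dp_minimal (complete_theory (og_structure S)) ->
  infinite_set X ->
  definable (M := og_structure S) X ->
  exists a b : G, (a < b)%O /\ [set x : G | (a < x < b)%O] `<=` X.
Proof.
move=> divG [nipG minG] Xinf defX.
(* Two distinct points of [X] have a quotient above 1, which gives a first radius. *)
have gt1_ex : exists c : G, (1%g < c)%O.
  have [h [_ hinj]] := infinite_set_seq Xinf.
  have : h 1%N != h 0%N by apply/eqP => /hinj.
  rewrite neq_lt => /orP[h10|h10].
    by exists ((h 1%N)^-1 * h 0%N)%g; rewrite -(ltmg2l (h 1%N)) mulg1 mulVKg.
  by exists ((h 0%N)^-1 * h 1%N)%g; rewrite -(ltmg2l (h 0%N)) mulg1 mulVKg.
have [Y [YX defY Yinf homY]] := homogeneous_subset minG gt1_ex nipG defX Xinf.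
have [x [c [c1 cY]]] := homogeneous_interior divG minG gt1_ex defY Yinf homY.
exists (x * c^-1)%g, (x * c)%g; split=> [|z /andP[cz zc]].
  by rewrite ltmg2l; apply: (lt_trans _ c1); rewrite ltVg1.
apply: YX; rewrite -(mulVKg x z); apply: cY; apply/andP; split.
  by rewrite -(ltmg2l x) mulVKg.
by rewrite -(ltmg2l x) mulVKg.
Qed.
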